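(* Let $(T,f,g)$ be a Lie-Yamaguti algebra over a field $k$ of characteristic zero, and let $(f_t,g_t)$ and $(f'_t,g'_t)$ be equivalent deformations of $(T,f,g)$, where $f_t=f+tF_1+t^2F_2+\cdots$, $g_t=g+tG_1+t^2G_2+\cdots$, $f'_t=f+tF'_1+t^2F'_2+\cdots$, $g'_t=g+tG'_1+t^2G'_2+\cdots$. Then the first-order terms $(F_1,G_1)$ and $(F'_1,G'_1)$ belong to the same cohomology class in the cohomology group $H^2(T,T)\times H^3(T,T)$.
   Context: **Lie-Yamaguti algebra (LYA).** Let $k$ be a field of characteristic zero. A Lie-Yamaguti algebra $(T,f,g)$ is a $k$-vector space $T$ with a bilinear map $f(a,b)=ab$ and a trilinear map $g(a,b,c)=[a,b,c]$ such that for all $a,b,c,d,e\in T$: (1) $aa=0$; (2) $[a,a,b]=0$; (3) $[a,b,c]+[b,c,a]+[c,a,b]+(ab)c+(bc)a+(ca)b=0$; (4) $[ab,c,d]+[bc,a,d]+[ca,b,d]=0$; (5) $[a,b,cd]=[a,b,c]d+c[a,b,d]$; (6) $[a,b,[c,d,e]]=[[a,b,c],d,e]+[c,[a,b,d],e]+[c,d,[a,b,e]]$. **Deformations.** A deformation of $(T,f,g)$ is a pair of formal power series $f_t=\sum_{i\ge 0}t^iF_i$, $g_t=\sum_{i\ge 0}t^iG_i$ with $F_i:T\times T\to T$ $k$-bilinear, $G_i:T\times T\times T\to T$ $k$-trilinear, $F_0=f$, $G_0=g$, such that, with all maps extended multilinearly over $k[[t]]$, identities (1)–(6) hold with $f_t(a,b)$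 in place of $ab$ and $g_t(a,b,c)$ in place of $[a,b,c]$, as identities of formal power series in $t$ with coefficients in $T$, for all $a,b,c,d,e\in T$. The deformation $(f'_t,g'_t)$ is equivalent to $(f_t,g_t)$ if there is $\Phi_t=1_T+t\varphi_1+t^2\varphi_2+\cdots$, with all $\varphi_i:T\to T$ $k$-linear (extended $k[[t]]$-linearly), such that $f'_t(a,b)=\Phi_t^{-1}f_t(\Phi_t(a),\Phi_t(b))$ and $g'_t(a,b,c)=\Phi_t^{-1}g_t(\Phi_t(a),\Phi_t(b),\Phi_t(c))$ for all $a,b,c\in T$. **Cohomology (coefficients in the regular representation).** Put $\rho(a)b=ab$, $D(a,b)c=[a,b,c]$, $\theta(a,b)c=[c,a,b]$. $C^1(T,T)$ is the space of linear maps $T\to T$. $C^2(T,T)$ is the space of bilinear maps $F:T\times T\to T$ with $F(a,a)=0$, and $C^3(T,T)$ is the space of trilinear maps $G:T\times T\times T\to T$ with $G(a,a,b)=0$. For $\varphi\in C^1(T,T)$, $\delta(\varphi,\varphi)=(\delta_{\rm I}\varphi,\delta_{\rm II}\varphi)\in C^2(T,T)\times C^3(T,T)$, where $(\delta_{\rm I}\varphi)(a,b)=\rho(a)\varphi(b)-\rho(b)\varphi(a)-\varphi(ab)$, $(\delta_{\rm II}\varphi)(a,b,c)=\theta(b,c)\varphi(a)-\theta(a,c)\varphi(b)+D(a,b)\varphi(c)-\varphi([a,b,c])$. For $(F,G)\in C^2(T,T)\times C^3(T,T)$, $\delta(F,G)=(\delta_{\rm I}F,\delta_{\rm II}G)$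 and $\delta^*(F,G)=(\delta^*_{\rm I}F,\delta^*_{\rm II}G)$, where (each component may depend on both $F$ and $G$) $(\delta_{\rm I}F)(x_1,x_2,x_3,x_4)=-[\rho(x_3)G(x_1,x_2,x_4)-\rho(x_4)G(x_1,x_2,x_3)-G(x_1,x_2,x_3x_4)]+D(x_1,x_2)F(x_3,x_4)-F([x_1,x_2,x_3],x_4)-F(x_3,[x_1,x_2,x_4])$, $(\delta_{\rm II}G)(x_1,\dots,x_5)=-[\theta(x_4,x_5)G(x_1,x_2,x_3)-\theta(x_3,x_5)G(x_1,x_2,x_4)]+D(x_1,x_2)G(x_3,x_4,x_5)-D(x_3,x_4)G(x_1,x_2,x_5)-G([x_1,x_2,x_3],x_4,x_5)-G(x_3,[x_1,x_2,x_4],x_5)-G(x_3,x_4,[x_1,x_2,x_5])+G(x_1,x_2,[x_3,x_4,x_5])$, $(\delta^*_{\rm I}F)(a,b,c)=-\rho(a)F(b,c)-\rho(b)F(c,a)-\rho(c)F(a,b)+F(ab,c)+F(bc,a)+F(ca,b)+G(a,b,c)+G(b,c,a)+G(c,a,b)$, $(\delta^*_{\rm II}G)(a,b,c,d)=\theta(a,d)F(b,c)+\theta(b,d)F(c,a)+\theta(c,d)F(a,b)+G(ab,c,d)+G(bc,a,d)+G(ca,b,d)$. $Z^2(T,T)\times Z^3(T,T)$ denotes the space of pairs $(F,G)\in C^2(T,T)\times C^3(T,T)$ with $\delta(F,G)=0$ and $\delta^*(F,G)=0$; $B^2(T,T)\times B^3(T,T)=\{\delta(\varphi,\varphi):\varphi\in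 C^1(T,T)\}$; and $H^2(T,T)\times H^3(T,T)$ is the quotient $(Z^2(T,T)\times Z^3(T,T))/(B^2(T,T)\times B^3(T,T))$. *)

(* Defs.v *)
From HB Require Import structures.
From mathcomp Require Import all_boot all_algebra.
From mathcomp Require Import boolp classical_sets functions.

Set Implicit Arguments.
Unset Strict Implicit.
Unset Printing Implicit Defensive.

Import GRing.Theory.
Local Open Scope classical_set_scope.
Local Open Scope ring_scope.

Section Multilinear.
Context {k : fieldType} {T : lmodType k}.

Definition bilinear_map (F : T -> T -> T) : Prop :=
  (forall b, linear (fun a => F a b)) /\ (forall a, linear (fun b => F a b)).

Definition trilinear_map (G : T -> T -> T -> T) : Prop :=
  [/\ forall b c, linear (fun a => G a b c),
      forall a c, linear (fun b => G a b c) &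
      forall a b, linear (fun c => G a b c)].

End Multilinear.

(* The six identities are stated for operations on an arbitrary abelian group,
   so that they can be used both in T and in T[[t]]. *)
Definition LY_identities (V : zmodType) (f : V -> V -> V)
    (g : V -> V -> V -> V) (a b c d e : V) : Prop :=
  [/\ f a a = 0,
      g a a b = 0,
      g a b c + g b c a + g c a b
        + f (f a b) c + f (f b c) a + f (f c a) b = 0,
      g (f a b) c d + g (f b c) a d + g (f c a) b d = 0 &
      g a b (f c d) = f (g a b c) d + f c (g a b d) /\
      g a b (g c d e) = g (g a b c) d e + g c (g a b d) e + g c d (g a b e)].

Definition is_LYA (k : fieldType) (T : lmodType k) (f : T -> T -> T)
    (g : T -> T -> T -> T) : Prop :=
  [/\ bilinear_map f, trilinear_map g &
      forall a b c d e : T, LY_identities f g a b c d e].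

(* [fps T] is T[[t]]: the sequence u stands for the sum of the t^n u_n. The
   abelian group structure is the pointwise one. *)
Notation fps T := (nat -> T) (only parsing).

Section FormalPowerSeries.
Context {k : fieldType} {T : lmodType k}.

Definition fps_const (a : T) : fps T := fun n => if n == 0%N then a else 0.

(* The k[[t]]-multilinear extensions to T[[t]] of formal power series of maps:
   the coefficient of t^n collects all the terms of total degree n. *)
Definition fps_ext1 (P : nat -> T -> T) (u : fps T) : fps T :=
  fun n => \sum_(i < n.+1) \sum_(j < n.+1 | (i + j == n)%N) P i (u j).

Definition fps_ext2 (F : nat -> T -> T -> T) (u v : fps T) : fps T :=
  fun n => \sum_(i < n.+1) \sum_(j < n.+1) \sum_(l < n.+1 | (i + j + l == n)%N)
    F i (u j) (v l).

Definition fps_ext3 (G : nat -> T -> T -> T -> T) (u v w : fps T) : fps T :=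
  fun n => \sum_(i < n.+1) \sum_(j < n.+1) \sum_(l < n.+1)
    \sum_(m < n.+1 | (i + j + l + m == n)%N) G i (u j) (v l) (w m).

(* The inverse of Phi = 1 + t P_1 + t^2 P_2 + ... is the Neumann series
   \sum_m (1 - Phi)^m; since 1 - Phi raises the t-adic order, only the terms
   m <= n contribute to the coefficient of t^n. *)
Definition fps_inv1 (P : nat -> T -> T) (u : fps T) : fps T :=
  fun n => \sum_(m < n.+1) iter m (fun v => v - fps_ext1 P v) u n.

Section InverseCorrect.
Variable P : nat -> T -> T.
Hypothesis P0 : P 0%N = id.
Hypothesis Plin : forall i, linear (P i).

Let N (v : fps T) : fps T := v - fps_ext1 P v.

Let PB i a b : P i (a - b) = P i a - P i b.
Proof. by have := Plin i (-1) b a; rewrite !scaleN1r [a - b]addrC [RHS]addrC. Qed.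

Lemma fps_ext1E u n : fps_ext1 P u n = \sum_(i < n.+1) P i (u (n - i)%N).
Proof.
rewrite /fps_ext1; apply: eq_bigr => i _.
have ltni : (n - i < n.+1)%N by rewrite ltnS leq_subr.
rewrite (big_pred1 (Ordinal ltni)) // => j /=.
rewrite -val_eqE /=; apply/eqP/eqP => [ijn|->]; last by rewrite subnKC // -ltnS.
by rewrite -[X in (X - i)%N]ijn addKn.
Qed.

Lemma fps_ext1B u v : fps_ext1 P (u - v) = fps_ext1 P u - fps_ext1 P v.
Proof.
apply/funext => n; rewrite !fctE !fps_ext1E -sumrB.
by apply: eq_bigr => i _; rewrite -PB.
Qed.

Let NB u v : N (u - v) = N u - N v.
Proof. by rewrite /N fps_ext1B !opprB addrACA [RHS]addrACA; congr (_ + _); rewrite addrC. Qed.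

Let NE u n : N u n = - \sum_(i < n) P i.+1 (u (n - i.+1)%N).
Proof. by rewrite /N !fctE fps_ext1E big_ord_recl /= subn0 P0 opprD addNKr. Qed.

Let N_local u v n : (forall i, (i < n)%N -> u i = v i) -> N u n = N v n.
Proof.
move=> uv; rewrite !NE; congr (- _); apply: eq_bigr => i _; rewrite uv //.
by rewrite ltn_subrL /= (leq_ltn_trans _ (ltn_ord i)).
Qed.

Let N0 : N 0 = 0.
Proof. by rewrite -{1}(subrr (0 : fps T)) NB subrr. Qed.

Let iterN_lt u m n : (n < m)%N -> iter m N u n = 0.
Proof.
elim: m n => // m IH n ltnm; rewrite iterS (N_local (v := 0)) ?N0 // => i ltin.
by apply: IH; apply: leq_trans ltin _.
Qed.

Let invE u M n : (n < M)%N -> fps_inv1 P u n = \sum_(m < M) iter m N u n.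
Proof.
move=> ltnM; rewrite /fps_inv1 -/N -(subnKC ltnM) big_split_ord /=.
rewrite [X in _ = _ + X]big1 ?addr0 // => i _.
by apply: (@iterN_lt u (n.+1 + i)%N n); rewrite addSn ltnS leq_addr.
Qed.

Let N_sum u M : N (\sum_(m < M) iter m N u) = \sum_(m < M) iter m.+1 N u.
Proof.
elim: M => [|M IH]; first by rewrite !big_ord0 N0.
rewrite !big_ord_recr /= -IH -{1}[iter M N u]opprK NB.
by rewrite -[- iter M N u]sub0r NB N0 sub0r opprK.
Qed.

Let telescope u M n :
  \sum_(m < M) iter m N u n - \sum_(m < M) iter m.+1 N u n = u n - iter M N u n.
Proof.
elim: M => [|M IH]; first by rewrite !big_ord0 !subrr.
by rewrite !big_ord_recr opprD addrACA IH addrA subrK.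
Qed.

Let ext1N u : fps_ext1 P u = u - N u.
Proof. by rewrite /N subKr. Qed.

Lemma fps_inv1K : cancel (fps_inv1 P) (fps_ext1 P).
Proof.
move=> u; apply/funext => n; rewrite ext1N !fctE.
rewrite (N_local (v := \sum_(m < n.+1) iter m N u)); last first.
  by move=> i ltin; rewrite fct_sumE (@invE u n.+1) // ltnW.
by rewrite N_sum fct_sumE (@invE u n.+1) // telescope iterN_lt // subr0.
Qed.

Lemma fps_ext1K : cancel (fps_ext1 P) (fps_inv1 P).
Proof.
move=> u; apply/funext => n; rewrite (@invE _ n.+1) //.
have iterB m v w : iter m N (v - w) = iter m N v - iter m N w.
  by elim: m => //= m ->; rewrite NB.
rewrite ext1N.
under eq_bigr => m _ do rewrite iterB !fctE -iterSr.
by rewrite sumrB telescope iterN_lt // subr0.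
Qed.

End InverseCorrect.
End FormalPowerSeries.

Section Deformations.
Context {k : fieldType} {T : lmodType k}.

Definition is_deformation (f : T -> T -> T) (g : T -> T -> T -> T)
    (F : nat -> T -> T -> T) (G : nat -> T -> T -> T -> T) : Prop :=
  [/\ forall i, bilinear_map (F i),
      forall i, trilinear_map (G i),
      F 0%N = f, G 0%N = g &
      forall a b c d e : T,
        LY_identities (fps_ext2 F) (fps_ext3 G)
          (fps_const a) (fps_const b) (fps_const c)
          (fps_const d) (fps_const e)].

(* (F', G') is equivalent to (F, G). *)
Definition equivalent_deformation
    (F : nat -> T -> T -> T) (G : nat -> T -> T -> T -> T)
    (F' : nat -> T -> T -> T) (G' : nat -> T -> T -> T -> T) : Prop :=
  exists phi : nat -> T -> T,
    let Phi a := fps_ext1 phi (fps_const a) in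
    [/\ phi 0%N = id,
        forall i, linear (phi i),
        forall a b : T,
          fps_ext2 F' (fps_const a) (fps_const b)
          = fps_inv1 phi (fps_ext2 F (Phi a) (Phi b)) &
        forall a b c : T,
          fps_ext3 G' (fps_const a) (fps_const b) (fps_const c)
          = fps_inv1 phi (fps_ext3 G (Phi a) (Phi b) (Phi c))].

End Deformations.

Section Cohomology.
Context {k : fieldType} {T : lmodType k}.
Variables (f : T -> T -> T) (g : T -> T -> T -> T).

Definition LY_rho (a b : T) : T := f a b.
Definition LY_D (a b c : T) : T := g a b c.
Definition LY_theta (a b c : T) : T := g c a b.
Local Notation rho := LY_rho.
Local Notation D := LY_D.
Local Notation theta := LY_theta.

Definition C1 : set (T -> T) := [set phi | linear phi].
Definition C2 : set (T -> T -> T) :=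
  [set F | bilinear_map F /\ forall a, F a a = 0].
Definition C3 : set (T -> T -> T -> T) :=
  [set G | trilinear_map G /\ forall a b, G a a b = 0].

Local Notation cochain23 := ((T -> T -> T) * (T -> T -> T -> T))%type.

Definition delta1_I (phi : T -> T) (a b : T) : T :=
  rho a (phi b) - rho b (phi a) - phi (f a b).

Definition delta1_II (phi : T -> T) (a b c : T) : T :=
  theta b c (phi a) - theta a c (phi b) + D a b (phi c) - phi (g a b c).

Definition delta1 (phi : T -> T) : cochain23 :=
  (delta1_I phi, delta1_II phi).

Definition delta2_I (F : T -> T -> T) (G : T -> T -> T -> T)
    (x1 x2 x3 x4 : T) : T :=
  - (rho x3 (G x1 x2 x4) - rho x4 (G x1 x2 x3) - G x1 x2 (f x3 x4))
  + D x1 x2 (F x3 x4) - F (g x1 x2 x3) x4 - F x3 (g x1 x2 x4).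

Definition delta2_II (G : T -> T -> T -> T) (x1 x2 x3 x4 x5 : T) : T :=
  - (theta x4 x5 (G x1 x2 x3) - theta x3 x5 (G x1 x2 x4))
  + D x1 x2 (G x3 x4 x5) - D x3 x4 (G x1 x2 x5)
  - G (g x1 x2 x3) x4 x5 - G x3 (g x1 x2 x4) x5 - G x3 x4 (g x1 x2 x5)
  + G x1 x2 (g x3 x4 x5).

Definition delta2s_I (F : T -> T -> T) (G : T -> T -> T -> T)
    (a b c : T) : T :=
  - rho a (F b c) - rho b (F c a) - rho c (F a b)
  + F (f a b) c + F (f b c) a + F (f c a) b
  + G a b c + G b c a + G c a b.

Definition delta2s_II (F : T -> T -> T) (G : T -> T -> T -> T)
    (a b c d : T) : T :=
  theta a d (F b c) + theta b d (F c a) + theta c d (F a b)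
  + G (f a b) c d + G (f b c) a d + G (f c a) b d.

Definition delta2 (p : cochain23) :
    (T -> T -> T -> T -> T) * (T -> T -> T -> T -> T -> T) :=
  (delta2_I p.1 p.2, delta2_II p.2).

Definition delta2s (p : cochain23) :
    (T -> T -> T -> T) * (T -> T -> T -> T -> T) :=
  (delta2s_I p.1 p.2, delta2s_II p.1 p.2).

Definition Z23 : set cochain23 :=
  [set p | [/\ C2 p.1, C3 p.2, delta2 p = 0 & delta2s p = 0]].

Definition B23 : set cochain23 := [set delta1 phi | phi in C1].

(* Since B23 is contained in Z23 for a Lie-Yamaguti algebra, this is the coset
   z + B23 when z is a cocycle. *)
Definition cohomology_class (z : cochain23) : set cochain23 :=
  [set w | Z23 w /\ B23 (w - z)].

(* The quotient Z23 / B23, as the set of its classes. *)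
Definition H23 : set (set cochain23) := [set cohomology_class z | z in Z23].

End Cohomology.

(* Main.v *)
Require Import Defs.
From mathcomp Require Import all_boot all_algebra.
From mathcomp Require Import boolp classical_sets functions.
Local Open Scope ring_scope.

(** Everything happens in the coefficients of t^0 and t^1.

    Comparing the coefficients of t in the six identities of a deformation
    [(F, G)] says that its infinitesimal [(F_1, G_1)] is a pair of alternating
    maps killed by [delta] and [delta*]: the two alternating laws give the
    alternation, the two cyclic identities give [delta* = 0], and the two
    derivation identities give [delta = 0], up to the antisymmetry of f and of
    g in its first two arguments ([deformation_infinitesimal_cocycle]).

    Applying Phi to both sides, equivalence reads
    Phi f'_t(a, b) = f_t(Phi a, Phi b), and similarly for g. The coefficient of
    t in these equations is exactly
    (F'_1, G'_1) - (F_1, G_1) = delta(phi_1, phi_1)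
    ([equivalent_infinitesimal_coboundary]). Hence both infinitesimals lie in
    the class of [(F_1, G_1)]. *)

Set Implicit Arguments.
Unset Strict Implicit.
Unset Printing Implicit Defensive.
Import GRing.Theory.

Section LowOrderCoefficients.
Context {k : fieldType} {T : lmodType k}.
Implicit Types (u v w : nat -> T).

Lemma fps_ext1_coef0 (P : nat -> T -> T) u :
  fps_ext1 P u 0%N = P 0%N (u 0%N).
Proof. by rewrite /fps_ext1 big_ord1 big_mkcond big_ord1. Qed.

Lemma fps_ext1_coef1 (P : nat -> T -> T) u :
  fps_ext1 P u 1%N = P 0%N (u 1%N) + P 1%N (u 0%N).
Proof.
rewrite /fps_ext1; under eq_bigr do rewrite big_mkcond.
by rewrite !(big_ord_recl, big_ord0) /= !(addr0, add0r).
Qed.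

Lemma fps_ext2_coef0 (F : nat -> T -> T -> T) u v :
  fps_ext2 F u v 0%N = F 0%N (u 0%N) (v 0%N).
Proof. by rewrite /fps_ext2 !big_ord1 big_mkcond big_ord1. Qed.

Lemma fps_ext2_coef1 (F : nat -> T -> T -> T) u v :
  fps_ext2 F u v 1%N =
  F 0%N (u 0%N) (v 1%N) + F 0%N (u 1%N) (v 0%N) + F 1%N (u 0%N) (v 0%N).
Proof.
rewrite /fps_ext2; under eq_bigr do under eq_bigr do rewrite big_mkcond.
by rewrite !(big_ord_recl, big_ord0) /= !(addr0, add0r).
Qed.

Lemma fps_ext3_coef0 (G : nat -> T -> T -> T -> T) u v w :
  fps_ext3 G u v w 0%N = G 0%N (u 0%N) (v 0%N) (w 0%N).
Proof. by rewrite /fps_ext3 !big_ord1 big_mkcond big_ord1. Qed.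

Lemma fps_ext3_coef1 (G : nat -> T -> T -> T -> T) u v w :
  fps_ext3 G u v w 1%N =
  G 0%N (u 0%N) (v 0%N) (w 1%N) + G 0%N (u 0%N) (v 1%N) (w 0%N)
  + G 0%N (u 1%N) (v 0%N) (w 0%N) + G 1%N (u 0%N) (v 0%N) (w 0%N).
Proof.
rewrite /fps_ext3.
under eq_bigr do under eq_bigr do under eq_bigr do rewrite big_mkcond.
by rewrite !(big_ord_recl, big_ord0) /= !(addr0, add0r).
Qed.

Definition fps_coef01 :=
  (fps_ext1_coef0, fps_ext1_coef1, fps_ext2_coef0, fps_ext2_coef1,
   fps_ext3_coef0, fps_ext3_coef1).

End LowOrderCoefficients.

Section MultilinearTheory.
Context {k : fieldType} {T : lmodType k}.
Implicit Types (F : T -> T -> T) (G : T -> T -> T -> T).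

Lemma linear_fun0 (h : T -> T) : linear h -> h 0 = 0.
Proof.
by move=> hl; have := hl (-1) 0 0; rewrite scaler0 addr0 scaleN1r addNr.
Qed.

Lemma bilinear_map0l F b : bilinear_map F -> F 0 b = 0.
Proof. by move=> [/(_ b)/linear_fun0]. Qed.

Lemma bilinear_map0r F a : bilinear_map F -> F a 0 = 0.
Proof. by move=> [_ /(_ a)/linear_fun0]. Qed.

Lemma trilinear_map0l G b c : trilinear_map G -> G 0 b c = 0.
Proof. by move=> [/(_ b c)/linear_fun0]. Qed.

Lemma trilinear_map0m G a c : trilinear_map G -> G a 0 c = 0.
Proof. by move=> [_ /(_ a c)/linear_fun0]. Qed.

Lemma trilinear_map0r G a b : trilinear_map G -> G a b 0 = 0.
Proof. by move=> [_ _ /(_ a b)/linear_fun0]. Qed.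

Lemma alternating_skew F : bilinear_map F -> (forall a, F a a = 0) ->
  forall a b, F a b = - F b a.
Proof.
move=> [Fl Fr] F0 a b; apply/eqP; rewrite -addr_eq0; apply/eqP.
have FDl x y z : F (x + y) z = F x z + F y z.
  by have := Fl z 1 x y; rewrite !scale1r.
have FDr x y z : F x (y + z) = F x y + F x z.
  by have := Fr x 1 y z; rewrite !scale1r.
by have := F0 (a + b); rewrite FDl !FDr !F0 add0r addr0.
Qed.

End MultilinearTheory.

Section Infinitesimal.
Context {k : fieldType} {T : lmodType k}.
Variables (f : T -> T -> T) (g : T -> T -> T -> T).
Hypothesis hT : is_LYA f g.

Let hf : bilinear_map f. Proof. by case: hT. Qed.
Let hg : trilinear_map g. Proof. by case: hT. Qed.

Lemma LYA_skew2 a b : f a b = - f b a.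
Proof.
by apply: alternating_skew => // x; case: hT => _ _ /(_ x x x x x) [].
Qed.

Lemma LYA_skew3 a b c : g a b c = - g b a c.
Proof.
apply: (@alternating_skew _ _ (fun x y => g x y c)).
  by case: hg => gl gm _; split=> x; [apply: gl | apply: gm].
by move=> x; case: hT => _ _ /(_ x c x x x) [].
Qed.

Let LYA0 :=
  (fun b => bilinear_map0l b hf, fun a => bilinear_map0r a hf,
   fun b c => trilinear_map0l b c hg, fun a c => trilinear_map0m a c hg,
   fun a b => trilinear_map0r a b hg, @addr0 T, @add0r T).

(** The infinitesimal of a deformation is a cocycle. In each identity the
    coefficient of t collects the terms in which exactly one operation is
    replaced by its first-order part; the arguments, being constant, contribute
    nothing to it. *)
Lemma deformation_infinitesimal_cocycle
    (F : nat -> T -> T -> T) (G : nat -> T -> T -> T -> T) :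
  is_deformation f g F G -> Z23 f g (F 1%N, G 1%N).
Proof.
move=> [hF hG F0 G0 H]; split=> /=.
- split=> [|a]; first exact: hF.
  case: (H a a a a a) => /(congr1 (@^~ 1%N)) + _ _ _ _.
  by rewrite !fps_coef01 F0 /fps_const /= !LYA0.
- split=> [|a b]; first exact: hG.
  case: (H a b a a a) => _ /(congr1 (@^~ 1%N)) + _ _ _.
  by rewrite !fps_coef01 G0 /fps_const /= !LYA0.
- suff [EI EII] : delta2_I f g (F 1%N) (G 1%N) = (fun _ _ _ _ => 0) /\
                  delta2_II g (G 1%N) = (fun _ _ _ _ _ => 0).
    by rewrite /delta2 /= EI EII.
  split.
    apply/funext => a; apply/funext => b; apply/funext => c; apply/funext => d.
    rewrite /delta2_I /LY_rho /LY_D (LYA_skew2 d) opprK.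
    case: (H a b c d a) => _ _ _ _ [/(congr1 (@^~ 1%N)) E _].
    move: E; rewrite !fctE !fps_coef01 F0 G0 /fps_const /= !LYA0.
    (* What is left is the difference of the two sides of the coefficient
       identity, with its terms in another order. *)
    move=> /eqP; rewrite -subr_eq0 => /eqP <-.
    by rewrite !opprD !opprK !addrA [LHS](ACl (4*3*2*5*1*6)).
  apply/funext => a; apply/funext => b; apply/funext => c; apply/funext => d.
  apply/funext => e.
  rewrite /delta2_II /LY_theta /LY_D (LYA_skew3 (G 1%N a b d)) opprK.
  case: (H a b c d e) => _ _ _ _ [_ /(congr1 (@^~ 1%N)) E].
  move: E; rewrite !fctE !fps_coef01 G0 /fps_const /= !LYA0.
  move=> /eqP; rewrite -subr_eq0 => /eqP <-.
  by rewrite !opprD !addrA [LHS](ACl (3*8*1*5*2*6*4*7)).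
- suff [EI EII] : delta2s_I f (F 1%N) (G 1%N) = (fun _ _ _ => 0) /\
                  delta2s_II f g (F 1%N) (G 1%N) = (fun _ _ _ _ => 0).
    by rewrite /delta2s /= EI EII.
  split.
    apply/funext => a; apply/funext => b; apply/funext => c.
    rewrite /delta2s_I /LY_rho.
    rewrite (LYA_skew2 a) (LYA_skew2 b (F 1%N c a)) (LYA_skew2 c) !opprK.
    case: (H a b c a a) => _ _ /(congr1 (@^~ 1%N)) + _ _.
    rewrite !fctE !fps_coef01 F0 G0 /fps_const /= !LYA0 => E.
    by rewrite -[RHS]E !addrA [LHS](ACl (7*8*9*3*4*1*5*2*6)).
  apply/funext => a; apply/funext => b; apply/funext => c; apply/funext => d.
  rewrite /delta2s_II /LY_theta.
  case: (H a b c d a) => _ _ _ /(congr1 (@^~ 1%N)) + _.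
  rewrite !fctE !fps_coef01 F0 G0 /fps_const /= !LYA0 => E.
  by rewrite -[RHS]E !addrA [LHS](ACl (3*4*1*5*2*6)).
Qed.

Lemma B23_0 : B23 f g 0.
Proof.
exists (fun=> 0); first by move=> c x y; rewrite scaler0 addr0.
suff [EI EII] : delta1_I f (fun=> 0) = (fun _ _ => 0) /\
                delta1_II g (fun=> 0) = (fun _ _ _ => 0).
  by rewrite /delta1 EI EII.
rewrite /delta1_I /delta1_II /LY_rho /LY_theta /LY_D.
split; apply/funext => a; apply/funext => b; first by rewrite /= !(LYA0, oppr0).
by apply/funext => c; rewrite /= !(LYA0, oppr0).
Qed.

(** The infinitesimals of equivalent deformations differ by the coboundary of
    the first-order term of the equivalence. *)
Lemma equivalent_infinitesimal_coboundary
    (F F' : nat -> T -> T -> T) (G G' : nat -> T -> T -> T -> T) :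
  F 0%N = f -> G 0%N = g -> F' 0%N = f -> G' 0%N = g ->
  equivalent_deformation F G F' G' ->
  B23 f g ((F' 1%N, G' 1%N) - (F 1%N, G 1%N)).
Proof.
move=> F0 G0 F'0 G'0 [phi [phi0 philin eqF eqG]].
exists (phi 1%N); first exact: philin.
suff [EI EII] : delta1_I f (phi 1%N) = (fun a b => F' 1%N a b - F 1%N a b) /\
    delta1_II g (phi 1%N) = (fun a b c => G' 1%N a b c - G 1%N a b c).
  by rewrite /delta1 EI EII.
split.
  apply/funext => a; apply/funext => b.
  rewrite /delta1_I /LY_rho (LYA_skew2 b) opprK.
  have := congr1 (fps_ext1 phi) (eqF a b); rewrite fps_inv1K //.
  move=> /(congr1 (@^~ 1%N)).
  rewrite !fps_coef01 F0 F'0 phi0 /fps_const /= !LYA0.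
  move=> /eqP; rewrite -subr_eq => /eqP <-.
  by rewrite [LHS]addrAC addrK.
apply/funext => a; apply/funext => b; apply/funext => c.
rewrite /delta1_II /LY_theta /LY_D (LYA_skew3 (phi 1%N b)) opprK.
have := congr1 (fps_ext1 phi) (eqG a b c); rewrite fps_inv1K //.
move=> /(congr1 (@^~ 1%N)).
rewrite !fps_coef01 G0 G'0 phi0 /fps_const /= !LYA0.
move=> /eqP; rewrite -subr_eq => /eqP E.
by rewrite [LHS](ACl (3*2*1*4)) /= -E [LHS]addrAC addrK.
Qed.

End Infinitesimal.

Theorem theorem4p1 (k : fieldType) (k_char0 : [pchar k] =i pred0)
    (T : lmodType k) (f : T -> T -> T) (g : T -> T -> T -> T)
    (hT : is_LYA f g)
    (F : nat -> T -> T -> T) (G : nat -> T -> T -> T -> T)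
    (F' : nat -> T -> T -> T) (G' : nat -> T -> T -> T -> T)
    (hFG : is_deformation f g F G) (hFG' : is_deformation f g F' G')
    (heq : equivalent_deformation F G F' G') :
  exists2 c, H23 f g c & c (F 1%N, G 1%N) /\ c (F' 1%N, G' 1%N).
Proof.
have Z := deformation_infinitesimal_cocycle hT hFG.
exists (cohomology_class f g (F 1%N, G 1%N)); first by exists (F 1%N, G 1%N).
split; split=> //; first by rewrite subrr; apply: B23_0.
  exact (deformation_infinitesimal_cocycle hT hFG').
case: hFG hFG' => _ _ F0 G0 _ [_ _ F'0 G'0 _].
exact: equivalent_infinitesimal_coboundary.
Qed.
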